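(* Let $G$ be a quiver without loops and $n\ge0$ an integer. Then a singular simplicial map $f\colon\Delta^n\to G$ (a quiver map) is an inclusion if and only if it is a homomorphism. In particular, $H_*^{\Delta,i}(G)=H_*^{\Delta,h}(G)$.
   Context: A quiver $G=(V_G,E_G,s_G,t_G)$ consists of a non-empty set $V_G$ of vertices, a set $E_G$ of edges and functions $s_G,t_G\colon E_G\to V_G$. A loop is an edge $e$ with $s(e)=t(e)$. A quiver map $m\colon G\to G'$ is a pair $m_V\colon V_G\to V_{G'}$, $m_E\colon E_G\to E_{G'}\sqcup V_{G'}$ such that each edge $e$ is sent either to an edge with source $m_V(s(e))$ and target $m_V(t(e))$, or to the vertex $m_V(s(e))=m_V(t(e))$. A homomorphism is a quiver map sending edges to edges; an inclusion is a homomorphism with $m_V$ and $m_E$ injective. $R$ is a fixed commutative ring. $\Delta^n$ is the quiver with vertices $0,\dots,n$ and exactly one edge $a\to b$ for each $a<b$ (no other edges); for $0\le i\le n$, $\delta_i\colon\Delta^{n-1}\to\Delta^n$ is the unique homomorphism with $\delta_i(j)=j$ for $j<i$ and $j+1$ otherwise. $C_n^{\Delta,h}(G)$ and $C_n^{\Delta,i}(G)$ are the free $R$-modules on homomorphisms, respectively inclusions, $f\colon\Delta^n\to G$, with differential $\partial_n(f)=\sum_{i=0}^n(-1)^if\circ\delta_i$; $H_*^{\Delta,h}(G)$ and $H_*^{\Delta,i}(G)$ are their homologies. *)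

(* Defs.v *)
From HB Require Import structures.
From mathcomp Require Import all_boot all_order all_algebra finmap boolp zify.
From mathcomp.multinomials Require Import monalg.

Set Implicit Arguments.
Unset Strict Implicit.
Unset Printing Implicit Defensive.

Import GRing.Theory.
Local Open Scope ring_scope.
Local Open Scope quotient_scope.

(* The library's module structure on [{malg R[K]}] requires [1 != 0] in [R];
   the alias carries one over an arbitrary ring. *)
Section FreeModule.
Variables (R : pzRingType) (K : choiceType).

Definition free_module := {malg R[K]}.
HB.instance Definition _ := GRing.Zmodule.on free_module.

Implicit Types (g : free_module) (c : R) (k : K).

Definition free_scale c g : free_module :=
  mkmalg [fsfun k in msupp g => c * mcoeff k g].

Lemma free_scaleE c g k : mcoeff k (free_scale c g) = c * mcoeff k g.
Proof. by rewrite mcoeffE; case: msuppP => // _; rewrite mulr0. Qed.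

Fact free_scaleA c d g : free_scale c (free_scale d g) = free_scale (c * d) g.
Proof. by apply/malgP => k; rewrite !free_scaleE mulrA. Qed.

Fact free_scale1 : left_id 1 free_scale.
Proof. by move=> g; apply/malgP => k; rewrite free_scaleE mul1r. Qed.

Fact free_scaleDr : right_distributive free_scale +%R.
Proof.
by move=> c g h; apply/malgP => k; rewrite !(free_scaleE, mcoeffD) mulrDr.
Qed.

Fact free_scaleDl g : {morph free_scale^~ g : c d / c + d}.
Proof.
by move=> c d; apply/malgP => k; rewrite !(free_scaleE, mcoeffD) mulrDl.
Qed.

HB.instance Definition _ := GRing.Zmodule_isLmodule.Build R free_module
  free_scaleA free_scale1 free_scaleDr free_scaleDl.

Definition free_basis k : free_module := mkmalgU k 1.

Variables (M : lmodType R) (f : K -> M).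

Definition free_lift g : M := \sum_(k <- msupp g) mcoeff k g *: f k.

Lemma free_liftEw g (D : {fset K}) : (msupp g `<=` D)%fset ->
  free_lift g = \sum_(k <- D) mcoeff k g *: f k.
Proof.
move=> sgD; rewrite /free_lift (big_fset_incl _ sgD) // => k _.
by move=> /mcoeff_outdom ->; rewrite scale0r.
Qed.

Lemma free_lift_is_linear : linear free_lift.
Proof.
move=> c g h.
pose D := (msupp (c *: g + h) `|` msupp g `|` msupp h)%fset.
have s1 : (msupp (c *: g + h) `<=` D)%fset by rewrite /D -fsetUA fsubsetUl.
have s2 : (msupp g `<=` D)%fset.
  by apply/fsubsetP => k; rewrite /D !inE => ->; rewrite orbT.
have s3 : (msupp h `<=` D)%fset by rewrite /D fsubsetUr.
rewrite (free_liftEw s1) (free_liftEw s2) (free_liftEw s3).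
rewrite scaler_sumr -big_split /=; apply: eq_bigr => k _.
by rewrite mcoeffD [mcoeff k (c *: g)]free_scaleE scalerDl scalerA.
Qed.

HB.instance Definition _ := GRing.isLinear.Build R free_module M *:%R free_lift
  free_lift_is_linear.

Lemma free_lift_basis k : free_lift (free_basis k) = f k.
Proof.
rewrite (free_liftEw (D := [fset k]%fset) msuppU_le) big_seq_fset1.
by rewrite mcoeffUU scale1r.
Qed.

End FreeModule.

Lemma free_module_linear_eq (R : pzRingType) (K : choiceType) (M : lmodType R)
    (u v : {linear free_module R K -> M}) :
  (forall k, u (free_basis R k) = v (free_basis R k)) -> u =1 v.
Proof.
move=> uv g.
have -> : g = \sum_(k <- msupp g) mcoeff k g *: free_basis R k.
  rewrite [LHS](@monalgE K R g); apply: eq_bigr => k _; apply/malgP => k'.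
  rewrite [RHS]free_scaleE !mcoeffU.
  by case: eqP; rewrite /= ?mulr1n ?mulr1 ?mulr0n ?mulr0.
by rewrite !linear_sum; apply: eq_bigr => k _; rewrite !linearZ /= uv.
Qed.

Section QuotientModule.
Variables (R : pzRingType) (V : lmodType R) (W : submodClosed V).

Definition zmod_of_submod : zmodClosed V :=
  HB.pack (GRing.SubmodClosed.sort W)
    (GRing.isZmodClosed.Build V (GRing.SubmodClosed.sort W)
      (GRing.submod_closedB (submodClosedP W))).

Definition quotient_module := Quotient.quot zmod_of_submod.
HB.instance Definition _ := GRing.Zmodule.on quotient_module.
HB.instance Definition _ := EqQuotient.on quotient_module.

Definition quot_scale (a : R) := lift_op1 quotient_module ( *:%R a).

Lemma quot_piE (x y : V) : (\pi_quotient_module x == \pi y) = (x - y \in W).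
Proof. by rewrite -(@Quotient.idealrBE V zmod_of_submod). Qed.

Fact pi_quot_scale a :
  {morph \pi_quotient_module : x / a *: x >-> quot_scale a x}.
Proof.
move=> x; unlock quot_scale; apply/eqP; rewrite quot_piE -scalerBr.
by rewrite rpredZ // -quot_piE reprK.
Qed.

Fact pi_quotD : {morph \pi_quotient_module : x y / x + y}.
Proof. exact: (@pi_addr _ _ _ _ _ (Quotient.quot zmod_of_submod)). Qed.

Fact quot_scaleA a b u : quot_scale a (quot_scale b u) = quot_scale (a * b) u.
Proof. by rewrite -[u]reprK -!pi_quot_scale scalerA. Qed.

Fact quot_scale1 : left_id 1 quot_scale.
Proof. by move=> u; rewrite -[u]reprK -!pi_quot_scale scale1r. Qed.

Fact quot_scaleDr : right_distributive quot_scale +%R.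
Proof.
move=> a u v; rewrite -[u]reprK -[v]reprK -pi_quotD -!pi_quot_scale.
by rewrite scalerDr pi_quotD.
Qed.

Fact quot_scaleDl u : {morph quot_scale^~ u : a b / a + b}.
Proof.
by move=> a b; rewrite -[u]reprK -!pi_quot_scale scalerDl pi_quotD.
Qed.

HB.instance Definition _ := GRing.Zmodule_isLmodule.Build R quotient_module
  quot_scaleA quot_scale1 quot_scaleDr quot_scaleDl.

Definition quot_proj (x : V) : quotient_module := \pi x.

Fact quot_proj_is_linear : linear quot_proj.
Proof.
by move=> a x y; rewrite /quot_proj pi_quotD pi_quot_scale.
Qed.

HB.instance Definition _ := GRing.isLinear.Build R V quotient_module *:%R
  quot_proj quot_proj_is_linear.

Lemma quot_proj_eq x y : (quot_proj x == quot_proj y) = (x - y \in W).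
Proof. exact: quot_piE. Qed.

Lemma quot_proj_surj (u : quotient_module) : {x | u = quot_proj x}.
Proof. by exists (repr u); rewrite /quot_proj reprK. Qed.

End QuotientModule.

Section ChainComplex.
Variable R : pzRingType.

Record chain_complex := ChainComplex {
  chains : nat -> lmodType R;
  diff : forall n, {linear chains n.+1 -> chains n};
  diff_diff : forall n x, diff n (diff n.+1 x) = 0 }.

Section Homology.
Variables (C : chain_complex) (n : nat).

(* The differential on degree [0] is zero. *)
Definition is_cycle : {pred chains C n} :=
  match n return {pred chains C n} with
  | 0 => predT
  | m.+1 => fun x => diff C m x == 0
  end.

Fact is_cycle_submod : submod_closed is_cycle.
Proof.
rewrite /is_cycle; case: n => [|m]; first by [].
split=> [|a x y]; rewrite !unfold_in ?linear0 // linearP.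
by move=> /eqP -> /eqP ->; rewrite scaler0 addr0.
Qed.

HB.instance Definition _ := GRing.isSubmodClosed.Build R (chains C n) is_cycle
  is_cycle_submod.

Definition cycles := {x : chains C n | x \in is_cycle}.
HB.instance Definition _ := SubChoice.on cycles.
HB.instance Definition _ := [SubChoice_isSubLmodule of cycles by <:].

Definition is_boundary : {pred cycles} :=
  fun x => `[< exists y, diff C n y = val x >].

Fact is_boundary_submod : submod_closed is_boundary.
Proof.
split=> [|a x y]; rewrite !unfold_in.
  by apply/asboolP; exists 0; rewrite !linear0.
move=> /asboolP[x' hx] /asboolP[y' hy]; apply/asboolP.
by exists (a *: x' + y'); rewrite !linearP /= hx hy.
Qed.

HB.instance Definition _ := GRing.isSubmodClosed.Build R cycles is_boundary
  is_boundary_submod.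

Definition homology : lmodType R := quotient_module is_boundary.

Definition homology_class : {linear cycles -> homology} :=
  quot_proj is_boundary.

End Homology.

Arguments is_cycle C n : clear implicits.
Arguments is_boundary C n : clear implicits.

Record chain_map (C D : chain_complex) := ChainMap {
  cmap : forall n, {linear chains C n -> chains D n};
  cmap_diff : forall n x, cmap n (diff C n x) = diff D n (cmap n.+1 x) }.

Section HomologyMap.
Variables (C D : chain_complex) (f : chain_map C D) (n : nat).

Lemma cmap_cycle x : x \in is_cycle C n -> cmap f n x \in is_cycle D n.
Proof.
rewrite /is_cycle; case: n x => [//|m] x; rewrite !unfold_in => /eqP dx0.
by rewrite -cmap_diff dx0 linear0.
Qed.

Definition cycle_map (x : cycles C n) : cycles D n :=
  exist _ (cmap f n (val x)) (cmap_cycle (valP x)).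

Fact cycle_map_is_linear : linear cycle_map.
Proof. by move=> a x y; apply: val_inj; rewrite /= !linearP. Qed.

HB.instance Definition _ := GRing.isLinear.Build R (cycles C n) (cycles D n)
  *:%R cycle_map cycle_map_is_linear.

Definition homology_map (u : homology C n) : homology D n :=
  homology_class D n (cycle_map (repr u)).

Lemma homology_mapE x : homology_map (homology_class C n x) =
  homology_class D n (cycle_map x).
Proof.
apply/eqP; rewrite /homology_map quot_proj_eq -linearB /=.
set y := repr _; have : y - x \in is_boundary C n.
  by rewrite -quot_proj_eq /quot_proj reprK.
rewrite !unfold_in => /asboolP[z dz]; apply/asboolP; exists (cmap f n.+1 z).
by rewrite -cmap_diff dz.
Qed.

Fact homology_map_is_linear : linear homology_map.
Proof.
move=> a u v; have [x ->] := quot_proj_surj u; have [y ->] := quot_proj_surj v.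
by rewrite -[_ + _]linearP !homology_mapE !linearP.
Qed.

HB.instance Definition _ := GRing.isLinear.Build R (homology C n)
  (homology D n) *:%R homology_map homology_map_is_linear.

End HomologyMap.

End ChainComplex.

Arguments is_cycle {R} C n.
Arguments is_boundary {R} C n.
Arguments homology_map {R C D} f n u.

Record semisimplicial := SemiSimplicial {
  cell :> nat -> choiceType;
  face : forall n, 'I_n.+2 -> cell n.+1 -> cell n;
  face_face : forall n (i j : 'I_n.+2) x, (i <= j)%N ->
    face i (face (lift ord0 j) x) =
    face j (face (widen_ord (leqnSn n.+2) i) x) }.

Section SemisimplicialChains.
Variables (R : pzRingType) (X : semisimplicial).

Definition ss_diff n : {linear free_module R (X n.+1) -> free_module R (X n)} :=
  free_lift (fun x => \sum_(i < n.+2) (-1) ^+ i *: free_basis R (face i x)).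

Lemma ss_diff_basis n (x : X n.+1) : ss_diff n (free_basis R x) =
  \sum_(i < n.+2) (-1) ^+ i *: free_basis R (face i x).
Proof. exact: free_lift_basis. Qed.

Lemma ss_diff_diff n c : ss_diff n (ss_diff n.+1 c) = 0.
Proof.
pose u : {linear _ -> _} := ss_diff n \o ss_diff n.+1.
pose z : {linear free_module R (X n.+2) -> free_module R (X n)} := \0.
apply: (@free_module_linear_eq R _ _ u z) => x /=.
rewrite ss_diff_basis linear_sum /=.
under eq_bigr => j _ do rewrite linearZ /= ss_diff_basis scaler_sumr.
rewrite exchange_big /=.
pose F (i : 'I_n.+2) (j : 'I_n.+3) : free_module R (X n) :=
  (-1) ^+ j *: ((-1) ^+ i *: free_basis R (face i (face j x))).
transitivity (\sum_(i < n.+2) (\sum_(j < n.+2 | (i <= j)%N) F i (lift ord0 j) +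
   \sum_(j < n.+2 | (j <= i)%N) F i (widen_ord (leqnSn n.+2) j))).
  apply: eq_bigr => i _; rewrite (bigID (fun j : 'I__ => (i < j)%N)) /=.
  congr (_ + _).
    by rewrite big_mkcond big_ord_recl /= add0r -big_mkcond.
  rewrite big_mkcond big_ord_recr /= ltn_ord /= addr0 -big_mkcond.
  by apply: eq_bigl => j; rewrite -leqNgt.
rewrite big_split /= [X in _ + X](exchange_big_dep predT) //= -big_split /=.
apply: big1 => i _; rewrite -big_split big1 //= => j ij.
rewrite /F face_face //= /bump /= add1n exprS !scalerA -!scalerDl.
by rewrite -mulrA -!exprD [(j + i)%N]addnC mulN1r addNr scale0r.
Qed.

Definition ss_complex : chain_complex R := ChainComplex ss_diff_diff.

End SemisimplicialChains.

Record ss_map (X Y : semisimplicial) := SsMap {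
  smap : forall n, X n -> Y n;
  smap_face : forall n (i : 'I_n.+2) (x : X n.+1),
    smap (face i x) = face i (smap x) }.

Section SsChainMap.
Variables (R : pzRingType) (X Y : semisimplicial) (f : ss_map X Y).

Definition ss_cmap n : {linear free_module R (X n) -> free_module R (Y n)} :=
  free_lift (fun x => free_basis R (smap f x)).

Lemma ss_cmap_diff n c :
  ss_cmap n (ss_diff R X n c) = ss_diff R Y n (ss_cmap n.+1 c).
Proof.
pose u : {linear _ -> _} := ss_cmap n \o ss_diff R X n.
pose v : {linear _ -> _} := ss_diff R Y n \o ss_cmap n.+1.
apply: (@free_module_linear_eq R _ _ u v) => x.
rewrite /= ss_diff_basis linear_sum free_lift_basis ss_diff_basis.
apply: eq_bigr => i _.
by rewrite linearZ /= free_lift_basis smap_face.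
Qed.

Definition ss_chain_map : chain_map (ss_complex R X) (ss_complex R Y) :=
  @ChainMap R (ss_complex R X) (ss_complex R Y) ss_cmap ss_cmap_diff.

End SsChainMap.

Record quiver := Quiver {
  vertex : Type;
  edge : Type;
  src : edge -> vertex;
  tgt : edge -> vertex;
  vertex_inhabited : inhabited vertex }.

Definition is_loop (G : quiver) (e : edge G) := src e = tgt e.

Definition loopless (G : quiver) := forall e : edge G, ~ is_loop e.

Definition qmap_compat (G H : quiver) (mV : vertex G -> vertex H)
    (mE : edge G -> edge H + vertex H) :=
  forall e, match mE e with
            | inl e' => src e' = mV (src e) /\ tgt e' = mV (tgt e)
            | inr v => v = mV (src e) /\ v = mV (tgt e)
            end.

Record quiver_map (G H : quiver) := QuiverMap {
  mapV : vertex G -> vertex H;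
  mapE : edge G -> edge H + vertex H;
  qmapP : qmap_compat mapV mapE }.

HB.instance Definition _ (G H : quiver) := gen_eqMixin (quiver_map G H).
HB.instance Definition _ (G H : quiver) := gen_choiceMixin (quiver_map G H).

Lemma quiver_map_eq (G H : quiver) (f g : quiver_map G H) :
  mapV f =1 mapV g -> mapE f =1 mapE g -> f = g.
Proof.
case: f g => [fV fE fP] [gV gE gP] /= /funext eV /funext eE.
by case: _ / eV gP => gP; case: _ / eE gP => gP; congr QuiverMap.
Qed.

Definition homomorphism (G H : quiver) (f : quiver_map G H) :=
  forall e, exists e', mapE f e = inl e'.

Definition inclusion (G H : quiver) (f : quiver_map G H) :=
  [/\ homomorphism f, injective (mapV f) & injective (mapE f)].

Section Composition.
Variables (G H K : quiver) (g : quiver_map H K) (f : quiver_map G H).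

Definition qcompE (e : edge G) : edge K + vertex K :=
  match mapE f e with inl e' => mapE g e' | inr v => inr (mapV g v) end.

Lemma qcompP : qmap_compat (mapV g \o mapV f) qcompE.
Proof.
move=> e; rewrite /qcompE /=; have := qmapP f e.
case: (mapE f e) => [e'|v] [h1 h2]; last by split; congr (mapV g _).
have := qmapP g e'; rewrite h1 h2.
by case: (mapE g e').
Qed.

Definition qcomp : quiver_map G K := QuiverMap qcompP.

Lemma qcomp_homomorphism :
  homomorphism g -> homomorphism f -> homomorphism qcomp.
Proof.
by move=> hg hf e; have [e' fe] := hf e; rewrite /= /qcompE fe; apply: hg.
Qed.

Lemma qcomp_inclusion : inclusion g -> inclusion f -> inclusion qcomp.
Proof.
move=> [hg gV gE] [hf fV fE]; split; first exact: qcomp_homomorphism.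
  exact: inj_comp.
move=> e1 e2 /=; rewrite /qcompE; have [e1' E1] := hf e1.
have [e2' E2] := hf e2; rewrite E1 E2 => /gE e12.
by apply: fE; rewrite E1 E2 e12.
Qed.

End Composition.

Lemma qcompA (G H K L : quiver) (h : quiver_map K L) (g : quiver_map H K)
    (f : quiver_map G H) : qcomp h (qcomp g f) = qcomp (qcomp h g) f.
Proof.
apply: quiver_map_eq => // e.
by rewrite /= /qcompE /= /qcompE; case: (mapE f e).
Qed.

Section Simplex.

Definition simplex_edge (n : nat) := {p : 'I_n.+1 * 'I_n.+1 | (p.1 < p.2)%N}.

Definition simplex (n : nat) : quiver :=
  @Quiver 'I_n.+1 (simplex_edge n)
    (fun e => (val e).1) (fun e => (val e).2) (inhabits ord0).

Lemma lift_ltn n (i : 'I_n.+1) (a b : 'I_n) :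
  (a < b)%N -> (lift i a < lift i b)%N.
Proof. by rewrite /= !ltnNge leq_bump2. Qed.

(* [lift i j] is [j] if [j < i] and [j.+1] otherwise. *)
Definition coface_edge n (i : 'I_n.+2) (e : simplex_edge n) :
    simplex_edge n.+1 :=
  exist _ (lift i (val e).1, lift i (val e).2) (lift_ltn i (valP e)).

Lemma cofaceP n (i : 'I_n.+2) :
  @qmap_compat (simplex n) (simplex n.+1) (lift i) (inl \o coface_edge i).
Proof. by []. Qed.

Definition coface n (i : 'I_n.+2) : quiver_map (simplex n) (simplex n.+1) :=
  QuiverMap (cofaceP i).

Lemma coface_inclusion n (i : 'I_n.+2) : inclusion (coface i).
Proof.
split=> [e||]; [by exists (coface_edge i e) | exact: lift_inj |].
move=> [[a b] ab] [[c d] cd] [ac bd]; apply: val_inj => /=.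
by rewrite /bump in ac bd; congr pair; apply: (@lift_inj _ i); apply: val_inj.
Qed.

Lemma coface_unique n (i : 'I_n.+2)
    (f : quiver_map (simplex n) (simplex n.+1)) :
  homomorphism f -> mapV f =1 lift i -> f = coface i.
Proof.
move=> hf fV; apply: quiver_map_eq => // e; have [e' fe] := hf e.
have := qmapP f e; rewrite fe !fV /= => -[h1 h2]; congr inl.
by apply: val_inj => /=; rewrite -h1 -h2; case: (sval e').
Qed.

Lemma coface_coface n (i j : 'I_n.+2) : (i <= j)%N ->
  qcomp (coface (lift ord0 j)) (coface i) =
  qcomp (coface (widen_ord (leqnSn _) i)) (coface j).
Proof.
move=> ij.
have E (k : 'I_n.+1) : lift (lift ord0 j) (lift i k) =
    lift (widen_ord (leqnSn _) i) (lift j k).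
  apply: val_inj; rewrite /= /bump /=.
  by case: (leqP i k); case: (leqP j k); rewrite ?add0n ?add1n; lia.
by apply: quiver_map_eq => // e; congr inl; apply: val_inj; rewrite /= !E.
Qed.

End Simplex.

Section SingularSimplices.
Variable G : quiver.

Definition hom_simplex (n : nat) :=
  {f : quiver_map (simplex n) G | `[< homomorphism f >]}.
HB.instance Definition _ n := Choice.on (hom_simplex n).

Definition incl_simplex (n : nat) :=
  {f : quiver_map (simplex n) G | `[< inclusion f >]}.
HB.instance Definition _ n := Choice.on (incl_simplex n).

Fact hom_face_proof n (i : 'I_n.+2) (f : hom_simplex n.+1) :
  `[< homomorphism (qcomp (val f) (coface i)) >].
Proof.
have [hi _ _] := coface_inclusion i; apply/asboolP.
by apply: qcomp_homomorphism => //; apply/asboolP/(valP f).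
Qed.

Definition hom_face n (i : 'I_n.+2) (f : hom_simplex n.+1) : hom_simplex n :=
  exist _ (qcomp (val f) (coface i)) (hom_face_proof i f).

Fact hom_face_face n (i j : 'I_n.+2) (f : hom_simplex n.+2) : (i <= j)%N ->
  hom_face i (hom_face (lift ord0 j) f) =
  hom_face j (hom_face (widen_ord (leqnSn n.+2) i) f).
Proof.
by move=> ij; apply: val_inj; rewrite /= -!qcompA coface_coface.
Qed.

Definition hom_simplices := @SemiSimplicial hom_simplex hom_face hom_face_face.

Fact incl_face_proof n (i : 'I_n.+2) (f : incl_simplex n.+1) :
  `[< inclusion (qcomp (val f) (coface i)) >].
Proof.
apply/asboolP/qcomp_inclusion; last exact: coface_inclusion.
by apply/asboolP/(valP f).
Qed.

Definition incl_face n (i : 'I_n.+2) (f : incl_simplex n.+1) : incl_simplex n :=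
  exist _ (qcomp (val f) (coface i)) (incl_face_proof i f).

Fact incl_face_face n (i j : 'I_n.+2) (f : incl_simplex n.+2) : (i <= j)%N ->
  incl_face i (incl_face (lift ord0 j) f) =
  incl_face j (incl_face (widen_ord (leqnSn n.+2) i) f).
Proof.
by move=> ij; apply: val_inj; rewrite /= -!qcompA coface_coface.
Qed.

Definition incl_simplices :=
  @SemiSimplicial incl_simplex incl_face incl_face_face.

Fact incl_to_hom_proof n (f : incl_simplex n) : `[< homomorphism (val f) >].
Proof. by case: f => f /= /asboolP[hf _ _]; apply/asboolP. Qed.

Definition incl_to_hom n (f : incl_simplex n) : hom_simplex n :=
  exist _ (val f) (incl_to_hom_proof f).

Fact incl_to_hom_face n (i : 'I_n.+2) (f : incl_simplex n.+1) :
  incl_to_hom (incl_face i f) = hom_face i (incl_to_hom f).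
Proof. exact: val_inj. Qed.

Definition incl_to_hom_map : ss_map incl_simplices hom_simplices :=
  @SsMap incl_simplices hom_simplices incl_to_hom incl_to_hom_face.

End SingularSimplices.

Section QuiverHomology.
Variables (R : comPzRingType) (G : quiver).

Definition hom_chains : chain_complex R := ss_complex R (hom_simplices G).

Definition incl_chains : chain_complex R := ss_complex R (incl_simplices G).

(* Every inclusion is a homomorphism, so [incl_chains] is the subcomplex of
   [hom_chains] spanned by the inclusions; this is the embedding. *)
Definition incl_hom_chain_map : chain_map incl_chains hom_chains :=
  ss_chain_map R (incl_to_hom_map G).

Definition hom_homology (n : nat) : lmodType R := homology hom_chains n.

Definition incl_homology (n : nat) : lmodType R := homology incl_chains n.

(* The canonical comparison: the equality of the two homologies means that
   this linear map is bijective. *)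
Definition incl_hom_homology (n : nat) :
    {linear incl_homology n -> hom_homology n} :=
  homology_map incl_hom_chain_map n.

End QuiverHomology.

(* Main.v *)
(* An edge [a -> b] of the simplex with [f a = f b] would be sent by a
   homomorphism [f] to a loop, so [f] is injective on vertices; an edge of the
   simplex is determined by its endpoints, so [f] is then injective on edges.
   Both complexes thus have the same generators, and the embedding of one in
   the other is invertible already on generators. *)
Require Import Defs.
From mathcomp Require Import all_boot all_algebra.
From mathcomp Require Import boolp.

Set Implicit Arguments.
Unset Strict Implicit.
Unset Printing Implicit Defensive.

Lemma homomorphism_src_tgt (G H : quiver) (f : quiver_map G H)
    (e : edge G) (e' : edge H) :
  mapE f e = inl e' -> src e' = mapV f (src e) /\ tgt e' = mapV f (tgt e).
Proof. by move=> fe; have := qmapP f e; rewrite fe. Qed.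

Lemma simplex_homomorphism_injV (G : quiver) (n : nat)
    (f : quiver_map (simplex n) G) :
  loopless G -> homomorphism f -> injective (mapV f).
Proof.
move=> hG hf.
have neq (a b : 'I_n.+1) : (a < b)%N -> mapV f a <> mapV f b.
  move=> ab fab; pose e : edge (simplex n) := exist _ (a, b) ab.
  have [e' fe] := hf e; have [se te] := homomorphism_src_tgt fe.
  by apply: (hG e'); rewrite /is_loop se te.
(* [neq] treats only the pairs joined by an edge, those with [a < b]; the case [b < a] is its mirror
   image. *)
move=> a b fab; apply: val_inj; case: (ltngtP a b) => // [/neq|/neq] //.
by rewrite fab.
Qed.

Lemma simplex_homomorphism_inclusion (G : quiver) (n : nat)
    (f : quiver_map (simplex n) G) :
  loopless G -> homomorphism f -> inclusion f.
Proof.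
move=> hG hf; have fV := simplex_homomorphism_injV hG hf.
split=> // e1 e2; have [e fe2] := hf e2; rewrite fe2 => fe1.
have [s1 t1] := homomorphism_src_tgt fe1.
have [s2 t2] := homomorphism_src_tgt fe2.
(* Both edges have the same image [e], whose endpoints are the images of theirs. *)
have /fV s12 : mapV f (src e1) = mapV f (src e2) by rewrite -s1.
have /fV t12 : mapV f (tgt e1) = mapV f (tgt e2) by rewrite -t1.
by apply: val_inj; apply: injective_projections.
Qed.

(** Induced maps act on representing cycles, so a cancellation of chains in degree [n] passes to
    classes in that degree. *)
Lemma homology_map_cancel (R : pzRingType) (C D : chain_complex R)
    (f : chain_map C D) (g : chain_map D C) (n : nat) :
  cancel (cmap f n) (cmap g n) -> cancel (homology_map f n) (homology_map g n).
Proof.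
move=> fK u; have [x ->] := quot_proj_surj u.
rewrite [homology_map f n _]homology_mapE homology_mapE; congr quot_proj.
by apply: val_inj; rewrite /= fK.
Qed.

(** The composite and the identity are linear, so it suffices to compare them on the basis of
    simplices. *)
Lemma ss_cmap_cancel (R : pzRingType) (X Y : semisimplicial)
    (f : ss_map X Y) (g : ss_map Y X) (n : nat) :
  cancel (@smap _ _ f n) (@smap _ _ g n) ->
  cancel (ss_cmap R f n) (ss_cmap R g n).
Proof.
move=> fK c; pose u : {linear _ -> _} := ss_cmap R g n \o ss_cmap R f n.
pose v : {linear free_module R (X n) -> free_module R (X n)} := idfun.
apply: (@free_module_linear_eq R _ _ u v) => x.
by rewrite /= !free_lift_basis fK.
Qed.

Section LooplessQuiver.
Variables (G : quiver) (hG : loopless G).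

Fact hom_to_incl_proof n (f : hom_simplex G n) : `[< inclusion (val f) >].
Proof. exact/asboolP/simplex_homomorphism_inclusion/asboolP/(valP f). Qed.

Definition hom_to_incl n (f : hom_simplex G n) : incl_simplex G n :=
  exist _ (val f) (hom_to_incl_proof f).

Fact hom_to_incl_face n (i : 'I_n.+2) (f : hom_simplex G n.+1) :
  hom_to_incl (hom_face i f) = incl_face i (hom_to_incl f).
Proof. exact: val_inj. Qed.

Definition hom_to_incl_map : ss_map (hom_simplices G) (incl_simplices G) :=
  @SsMap (hom_simplices G) (incl_simplices G) hom_to_incl hom_to_incl_face.

End LooplessQuiver.

Theorem proposition3p1 (R : comPzRingType) (G : quiver) (hG : loopless G) :
  (forall (n : nat) (f : quiver_map (simplex n) G),
     inclusion f <-> homomorphism f) /\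
  (forall n : nat, bijective (@incl_hom_homology R G n)).
Proof.
split=> [n f|n].
  by split=> [[]//|]; apply: simplex_homomorphism_inclusion.
(* The inverse comes from regarding each homomorphism as an inclusion. Both composites keep the
   underlying quiver map, hence fix every simplex. *)
exists (homology_map (ss_chain_map R (hom_to_incl_map hG)) n).
  by apply/homology_map_cancel/ss_cmap_cancel => f; apply: val_inj.
by apply/homology_map_cancel/ss_cmap_cancel => f; apply: val_inj.
Qed.
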